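(* There exists $A>0$ such that for all integers $n\geq 0$, for any set $S$ of $n$ points in $\mathbb{R}^3$ and any function $r\colon S\to(0,\infty)$, \[e_r(S)\leq \frac{n^2}{4}+An^{5/3}.\]
   Context: Let $d(x,y)$ denote Euclidean distance in $\mathbb{R}^3$. For a finite set $S\subset\mathbb{R}^3$ and a function $r\colon S\to(0,\infty)$, let $\vec{E}_r(S)=\{(x,y) : x,y\in S,\ d(x,y)=r(x)\}$ (a set of ordered pairs) and $e_r(S)=|\vec{E}_r(S)|$. *)

(* Defs.v *)
From HB Require Import structures.
From mathcomp Require Import all_boot all_order all_algebra.
From mathcomp Require Import finmap.
From mathcomp Require Import all_classical all_reals all_analysis.

Set Implicit Arguments.
Unset Strict Implicit.
Unset Printing Implicit Defensive.

Import Order.TTheory GRing.Theory Num.Theory.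
Local Open Scope fset_scope.
Local Open Scope ring_scope.

(* Not `|x - y|: the library's norm on row vectors is the sup norm. *)
Definition edist (R : realType) (m : nat) (x y : 'rV[R]_m) : R :=
  Num.sqrt (\sum_(i < m) (x ord0 i - y ord0 i) ^+ 2).

(* [S : {fset T}] used as a type is the finite type of the elements of S. *)
Definition directed_edges (R : realType) (S : {fset 'rV[R]_3}) (r : S -> R) :
    {set S * S} :=
  [set p : S * S | edist (val p.1) (val p.2) == r p.1].

Definition num_edges (R : realType) (S : {fset 'rV[R]_3}) (r : S -> R) : nat :=
  #|directed_edges r|.

(* Main.v *)
(** Write [x -> y] for [d(x,y) = r(x)].  There are no [a], no distinct
    [b1, b2, b3] and no distinct [c1, c2, c3] with [a -> b_i -> c_j] for all
    [i], [j]: the vectors [b_i - b_1] are orthogonal to the [c_j - c_1], while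
    both triples lie on spheres (around [a], resp. [b_1]) and so span planes.
    Hence, by Kovari-Sos-Turan, the out-neighbours of any fixed [a] have
    [O(n^(5/3))] out-edges altogether.  Choosing [a] of maximum out-degree [D],
    the other [n - D] points have at most [(n - D) D <= n^2 / 4] out-edges. *)
From Pilot Require Import Defs.
From HB Require Import structures.
From mathcomp Require Import all_boot all_order all_algebra.
From mathcomp Require Import finmap.
From mathcomp Require Import all_classical all_reals all_analysis.
From mathcomp Require Import zify ring lra.

Set Implicit Arguments.
Unset Strict Implicit.
Unset Printing Implicit Defensive.

Import Order.TTheory GRing.Theory Num.Theory.
Local Open Scope fset_scope.
Local Open Scope ring_scope.

(* MathComp-Analysis has another [edist], in extended metric spaces. *)
Local Notation edist := Pilot.Defs.edist.

(** * Edge counts in finite directed graphs *)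

Section Combinatorics.
Local Open Scope nat_scope.

Lemma AGM3 (x y z : nat) : 3 * (x * y * z) <= x ^ 3 + y ^ 3 + z ^ 3.
Proof.
rewrite -(ler_nat int) !natrD !natrX !natrM.
(* This product is twice the difference of the two sides. *)
have : (0 <= (x%:R + y%:R + z%:R) *
  ((x%:R - y%:R) ^+ 2 + (x%:R - z%:R) ^+ 2 + (y%:R - z%:R) ^+ 2) :> int)%R.
  by rewrite mulr_ge0 ?addr_ge0 ?ler0n ?sqr_ge0.
nra.
Qed.

Lemma expn3_sum (I : finType) (F : I -> nat) :
  (\sum_i F i) ^ 3 = \sum_i \sum_j \sum_k F i * F j * F k.
Proof.
rewrite !expnS expn0 muln1 mulnA big_distrlr big_distrl; apply: eq_bigr => i _.
rewrite big_distrl; apply: eq_bigr => j _; exact: big_distrr.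
Qed.

(** AM-GM applied to each term [F i * F j * F k] of the expanded cube; each of the three cubes is
    then summed over two free indices. *)
Lemma expn3_sum_leq (I : finType) (F : I -> nat) :
  (\sum_i F i) ^ 3 <= #|I| ^ 2 * \sum_i F i ^ 3.
Proof.
rewrite -(leq_pmul2l (isT : 0 < 3)) expn3_sum.
have -> : 3 * (#|I| ^ 2 * \sum_i F i ^ 3)
          = \sum_i \sum_j \sum_k (F i ^ 3 + F j ^ 3 + F k ^ 3).
  set s := \sum_i F i ^ 3.
  under eq_bigr => i _.
    under eq_bigr => j _ do rewrite big_split /= sum_nat_const.
    rewrite big_split /= sum_nat_const -big_distrr /= big_split /=.
    rewrite sum_nat_const -/s; over.
  rewrite big_split /= sum_nat_const -big_distrr big_split /= -big_distrr /=.
  rewrite sum_nat_const -/s; ring.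
rewrite big_distrr; apply: leq_sum => i _.
rewrite big_distrr; apply: leq_sum => j _.
by rewrite big_distrr; apply: leq_sum => k _; apply: AGM3.
Qed.

Lemma sum_card_rel (T : finType) (e : rel T) :
  \sum_x #|[set y | e x y]| = \sum_x \sum_y (e x y : nat).
Proof.
by apply: eq_bigr => x _; rewrite -sum1dep_card big_mkcond; apply: eq_bigr.
Qed.

(** Double counting of the tuples [(x, y, z, c)] with edges from [x], [y], [z] to [c]. Their number
    is the sum of the cubed in-degrees, which the power mean inequality bounds from below by the
    cube of the edge count over [#|T| ^ 2]. *)
Lemma Kovari_Sos_Turan3 (T : finType) (e : rel T) (t : nat) :
  (forall x y z, x != y -> x != z -> y != z ->
     #|[set c | [&& e x c, e y c & e z c]]| <= t) ->
  (\sum_x #|[set y | e x y]|) ^ 3 <= (t + 3) * #|T| ^ 5.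
Proof.
move=> codeg; rewrite sum_card_rel exchange_big /=.
apply: leq_trans (expn3_sum_leq _) _.
have -> : (t + 3) * #|T| ^ 5 = #|T| ^ 2 * ((t + 3) * #|T| ^ 3) by ring.
rewrite leq_mul2l; apply/orP; right.
under eq_bigr => c _ do rewrite expn3_sum.
rewrite exchange_big /=.
under eq_bigr => x _.
  rewrite exchange_big /=.
  under eq_bigr => y _ do rewrite exchange_big /=.
  over.
(* A triple with a repetition gets only the trivial bound [#|T|]. There are at most [3 * #|T| ^ 2]
   such triples, whence the 3 in [t + 3]. *)
have codeg_le x y z : \sum_c e x c * e y c * e z c
    <= t + #|T| * ((x == y) + (x == z) + (y == z)).
  rewrite (_ : \sum_c _ = #|[set c | [&& e x c, e y c & e z c]]|); last first.
    rewrite -sum1dep_card [RHS]big_mkcond; apply: eq_bigr => c _.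
    by case: (e x c); case: (e y c); case: (e z c).
  have := max_card [set c | [&& e x c, e y c & e z c]].
  have [->|xy] := eqVneq x y; first by nia.
  have [->|xz] := eqVneq x z; first by nia.
  have [->|yz] := eqVneq y z; first by nia.
  by move=> _; rewrite muln0 addn0; apply: codeg.
have sum_eq (x : T) : \sum_y (x == y : nat) = 1.
  by rewrite (bigD1 x) //= eqxx big1 // => y /negPf; rewrite eq_sym => ->.
apply: leq_trans (_ : \sum_x \sum_y \sum_z
    (t + #|T| * ((x == y) + (x == z) + (y == z))) <= _).
  by do 3 (apply: leq_sum => ? _).
under eq_bigr => x _.
  under eq_bigr => y _.
    rewrite big_split /= sum_nat_const -big_distrr /= big_split /= sum_eq.
    rewrite big_split /= sum_nat_const sum_eq; over.
  rewrite big_split /= sum_nat_const -big_distrr /= big_split /= sum_nat_const.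
  rewrite big_split /= -big_distrr /= sum_eq sum_nat_const; over.
by rewrite sum_nat_const; apply: eq_leq; rewrite -[#|{: T}|]/#|T|; ring.
Qed.

Lemma card_rel_max_outdeg (T : finType) (e : rel T) (t : nat) :
  (forall a x y z, x != y -> x != z -> y != z -> e a x -> e a y -> e a z ->
     #|[set c | [&& e x c, e y c & e z c]]| <= t) ->
  exists D E : nat, [/\ D <= #|T|, E ^ 3 <= (t + 3) * #|T| ^ 5
    & \sum_x #|[set y | e x y]| <= (#|T| - D) * D + E].
Proof.
move=> codeg.
have [a0|T0] := pickP (@predT T); last first.
  by exists 0, 0; rewrite big1 // => x; have := T0 x.
move=> _.
have [a _ amax] := arg_maxnP (fun x => #|[set y | e x y]|) (isT : predT a0).
set N := [set y | e a y] in amax.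
(* [D] is the maximum out-degree, attained at [a]; [E] counts the edges that start in the
   out-neighbourhood [N] of [a]. *)
exists #|N|, (\sum_x #|[set y | (x \in N) && e x y]|); split.
- exact: max_card.
- apply: Kovari_Sos_Turan3 => x y z xy xz yz.
  (* In the graph restricted to sources in [N], a triple not contained in [N] has no common
     out-neighbour. *)
  have [Nxyz|Nxyz] := boolP [&& x \in N, y \in N & z \in N].
    move: Nxyz; rewrite !inE => /and3P[ax ay az].
    apply: leq_trans (codeg a x y z xy xz yz ax ay az).
    by rewrite ax ay az.
  rewrite (_ : [set c | _] = finset.set0) ?cards0 //.
  apply/setP => c; rewrite !inE; apply: contraNF Nxyz.
  by rewrite !inE => /and3P[/andP[-> _] /andP[-> _] /andP[-> _]].
rewrite (bigID (mem N)) /= addnC; apply: leq_add.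
  rewrite (_ : _ - _ = #|~: N|); last by rewrite [RHS]cardsCs finset.setCK.
  rewrite -sum_nat_const (eq_bigl (mem (~: N))) => [|x] /=.
    by apply: leq_sum => x _; apply: amax.
  by rewrite !inE.
rewrite [leqRHS](bigID (mem N)) /=; apply: leq_trans (leq_addr _ _).
by apply: leq_sum => x Nx; rewrite Nx.
Qed.

End Combinatorics.

(** * Euclidean inner product, spheres and bisectors *)

Section Geometry.
Variables (R : realType) (m : nat).
Implicit Types u v w x y : 'rV[R]_m.

Definition dot u v : R := \sum_i u ord0 i * v ord0 i.

Lemma dotC u v : dot u v = dot v u.
Proof. by apply: eq_bigr => i _; rewrite mulrC. Qed.

Lemma dotDl u v w : dot (u + v) w = dot u w + dot v w.
Proof. by rewrite -big_split; apply: eq_bigr => i _; rewrite mxE mulrDl. Qed.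

Lemma dotZl k u w : dot (k *: u) w = k * dot u w.
Proof. by rewrite /dot mulr_sumr; apply: eq_bigr => i _; rewrite mxE mulrA. Qed.

Lemma dotBl u v w : dot (u - v) w = dot u w - dot v w.
Proof. by rewrite -scaleN1r dotDl dotZl mulN1r. Qed.

Lemma dotBr u v w : dot w (u - v) = dot w u - dot w v.
Proof. by rewrite dotC dotBl !(dotC w). Qed.

Lemma dot_eq0 u : (dot u u == 0) = (u == 0).
Proof.
apply/eqP/eqP => [u0|->]; last by apply: big1 => i _; rewrite mxE mul0r.
apply/rowP => i; rewrite mxE; apply/eqP; rewrite -sqrf_eq0 expr2.
have /psumr_eq0P -> // : forall j, true -> 0 <= u ord0 j * u ord0 j.
by move=> j _; rewrite -expr2 sqr_ge0.
Qed.

Lemma edist_sqr x y : edist x y ^+ 2 = dot (x - y) (x - y).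
Proof.
rewrite sqr_sqrtr; last by apply: sumr_ge0 => i _; exact: sqr_ge0.
by apply: eq_bigr => i _; rewrite !mxE expr2.
Qed.

(** A line meets a sphere in at most two points, so three distinct points of a sphere are not
    collinear. *)
Lemma sphere_row_free c x y z (rho : R) :
  x != y -> x != z -> y != z ->
  edist c x = rho -> edist c y = rho -> edist c z = rho ->
  row_free (col_mx (y - x) (z - x)).
Proof.
move=> xy xz yz cx cy cz.
have chord p : edist c p = rho -> dot (p - x) (p - x) = 2 * dot (p - x) (c - x).
  move=> cp; have : edist c p ^+ 2 = edist c x ^+ 2 by rewrite cp cx.
  rewrite !edist_sqr !(dotBl, dotBr) (dotC p c) (dotC x c) (dotC p x); lra.
have {cx cy}u2 := chord y cy; have {cz chord}v2 := chord z cz.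
have u0 : dot (y - x) (y - x) != 0 by rewrite dot_eq0 subr_eq0 eq_sym.
have v0 : dot (z - x) (z - x) != 0 by rewrite dot_eq0 subr_eq0 eq_sym.
have uv0 : dot (y - x - (z - x)) (y - x - (z - x)) != 0.
  by rewrite dot_eq0 subr_eq0 (inj_eq (addIr _)).
move: (y - x) (z - x) (c - x) u2 v2 u0 v0 uv0 => u v w u2 v2 u0 v0 uv0.
rewrite !dotBl !dotBr (dotC v u) in uv0.
apply: inj_row_free => k; rewrite -[k]hsubmxK mul_row_col.
move: (lsubmx k) (rsubmx k) => a b.
rewrite (mx11_scalar a) (mx11_scalar b) !mul_scalar_mx.
move: (a 0 0) (b 0 0) => {k}{}a {}b ab0.
have dot_ab p : a * dot u p + b * dot v p = 0.
  by rewrite -!dotZl -dotDl ab0 -[0](scale0r 0) dotZl mul0r.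
(* For [a *: u + b *: v = 0], pairing with [w] and using the chord equations gives [asbq];
   subtracting the pairings with [v] and [u] gives [ha] and [hb]. If neither [a] nor [b] vanishes,
   then [dot u u = dot u v = dot v v], so [u - v] has norm zero. *)
have := dot_ab w; have := dot_ab u; have := dot_ab v.
rewrite (dotC v u); move=> abv abu abw.
have asbq : a * dot u u + b * dot v v = 0 by rewrite u2 v2; lra.
have ha : a * (dot u u - dot u v) = 0 by lra.
have hb : b * (dot v v - dot u v) = 0 by lra.
suff [-> ->] : a = 0 /\ b = 0.
  by rewrite -row_mx0; congr row_mx; apply/matrixP => i j; rewrite !mxE mul0rn.
move: ha hb => /eqP; rewrite mulf_eq0 => /orP[/eqP a0|/eqP us].
  move=> _; split=> //; move: abv; rewrite a0 mul0r add0r => /eqP.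
  by rewrite mulf_eq0 (negPf v0) orbF => /eqP.
move=> /eqP; rewrite mulf_eq0 => /orP[/eqP b0|/eqP vs].
  split=> //; move: abu; rewrite b0 mul0r addr0 => /eqP.
  by rewrite mulf_eq0 (negPf u0) orbF => /eqP.
by case/eqP: uv0; lra.
Qed.

(** Both [x] and [x'] lie on the perpendicular bisector of [y] and [y']; subtracting the two squared
    equalities leaves twice the inner product. *)
Lemma equidistant_orthogonal x x' y y' :
  edist x y = edist x y' -> edist x' y = edist x' y' ->
  (x' - x) *m (y' - y)^T = 0.
Proof.
move=> xy x'y; apply/matrixP => i j; rewrite !ord1 mxE [RHS]mxE.
under eq_bigr do rewrite [_^T _ _]mxE.
rewrite -/(dot (x' - x) (y' - y)).
have : edist x y ^+ 2 = edist x y' ^+ 2 by rewrite xy.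
have : edist x' y ^+ 2 = edist x' y' ^+ 2 by rewrite x'y.
rewrite !edist_sqr !(dotBl, dotBr).
rewrite (dotC y x) (dotC y' x) (dotC y x') (dotC y' x').
lra.
Qed.

End Geometry.

Lemma no_sphere_K33 (R : realType) (a b1 b2 b3 c1 c2 c3 : 'rV[R]_3)
    (rho s1 s2 s3 : R) :
  b1 != b2 -> b1 != b3 -> b2 != b3 -> c1 != c2 -> c1 != c3 -> c2 != c3 ->
  edist a b1 = rho -> edist a b2 = rho -> edist a b3 = rho ->
  edist b1 c1 = s1 -> edist b1 c2 = s1 -> edist b1 c3 = s1 ->
  edist b2 c1 = s2 -> edist b2 c2 = s2 -> edist b2 c3 = s2 ->
  edist b3 c1 = s3 -> edist b3 c2 = s3 -> edist b3 c3 = s3 -> False.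
Proof.
move=> b12 b13 b23 c12 c13 c23 ab1 ab2 ab3 bc11 bc12 bc13 bc21 bc22 bc23
  bc31 bc32 bc33.
have /eqP rB := sphere_row_free b12 b13 b23 ab1 ab2 ab3.
have /eqP rC := sphere_row_free c12 c13 c23 bc11 bc12 bc13.
have : col_mx (b2 - b1) (b3 - b1) *m (col_mx (c2 - c1) (c3 - c1))^T = 0.
  rewrite tr_col_mx mul_col_mx !mul_mx_row.
  by rewrite !equidistant_orthogonal ?row_mx0 ?col_mx0 //; congruence.
(* A zero product through dimension 3 forces the two ranks to add up to at most 3, yet both are
   2. *)
by move/mulmx0_rank_max; rewrite mxrank_tr rB rC.
Qed.

Theorem theorem3 (R : realType) :
  exists2 A : R, 0 < A &
    forall (n : nat) (S : {fset 'rV[R]_3}) (r : S -> R),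
      #|` S| = n ->
      (forall x : S, 0 < r x) ->
      (num_edges r)%:R <= n%:R ^+ 2 / 4 + A * n%:R `^ (5 / 3).
Proof.
(* With [t = 2] the error satisfies [E ^ 3 <= 5 * n ^ 5], and [5 <= 2 ^ 3]. *)
exists 2 => // n S r Sn _.
pose e : rel S := fun x y => edist (val x) (val y) == r x.
have codeg (a x y z : S) : x != y -> x != z -> y != z ->
    e a x -> e a y -> e a z -> (#|[set c | [&& e x c, e y c & e z c]]| <= 2)%N.
  move=> xy xz yz /eqP ax /eqP ay /eqP az; rewrite leqNgt; apply/negP.
  move/card_gt2P => [c1 [c2 [c3 [[]]]]]; rewrite !inE.
  move=> /and3P[/eqP xc1 /eqP yc1 /eqP zc1] /and3P[/eqP xc2 /eqP yc2 /eqP zc2].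
  move=> /and3P[/eqP xc3 /eqP yc3 /eqP zc3] [c12 c23 c31].
  apply: (no_sphere_K33 _ _ _ _ _ _ ax ay az
            xc1 xc2 xc3 yc1 yc2 yc3 zc1 zc2 zc3);
    by rewrite (inj_eq val_inj) // eq_sym.
have [D [E []]] := card_rel_max_outdeg codeg.
rewrite -cardfE Sn => Dn En.
have -> : (\sum_x #|[set y | e x y]|)%N = num_edges r.
  rewrite sum_card_rel pair_bigA /num_edges /directed_edges.
  rewrite -sum1dep_card [RHS]big_mkcond /=.
  by apply: eq_bigr => p _.
rewrite -(ler_nat R) natrD natrM natrB // => edges_le.
apply: le_trans edges_le _; apply: lerD.
  by have := sqr_ge0 (n%:R - 2 * D%:R : R); lra.
(* Cubing both sides removes the fractional exponent. *)
rewrite -(ler_pXn2r (isT : (0 < 3)%N)) ?nnegrE ?ler0n ?mulr_ge0 ?powR_ge0 //.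
rewrite exprMn -[(_ `^ _) ^+ 3]powR_mulrn ?powR_ge0 // -powRrM.
rewrite (_ : 5 / 3 * 3%:R = 5%:R :> R); last by field.
rewrite powR_mulrn ?ler0n //; move: En; rewrite -(ler_nat R) natrX natrM natrX.
have := exprn_ge0 5 (ler0n R n); lra.
Qed.
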